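(* Let $\lambda\in\mathbb{R}$, let $r\ge 0$ be an integer, and let $f(x)\in\mathbb{C}[[x]]$ be a formal power series. For every integer $k\ge 0$, $$x^{k}D^{k}f(x)=\sum_{m=0}^{k}(-1)^{k-m}{k+r \brack m+r}_{r,\lambda}(xD+r)_{m,\lambda}f(x).$$
   Context: $D=\frac{d}{dx}$ acts on formal power series $\mathbb{C}[[x]]$, and $x$ acts by multiplication; products of operators are compositions. For $\lambda\in\mathbb{R}$ and $y$ a number, indeterminate or operator, $(y)_{0,\lambda}=1$ and $(y)_{n,\lambda}=y(y-\lambda)(y-2\lambda)\cdots(y-(n-1)\lambda)$ for $n\ge 1$. Further $\langle y\rangle_{0}=1$, $\langle y\rangle_{n}=y(y+1)\cdots(y+n-1)$ for $n\ge1$, and $\langle y\rangle_{n,\lambda}=(-1)^{n}(-y)_{n,\lambda}$, i.e. $\langle y\rangle_{0,\lambda}=1$ and $\langle y\rangle_{n,\lambda}=y(y+\lambda)\cdots(y+(n-1)\lambda)$ for $n\ge 1$. For an integer $r\ge 0$, the unsigned degenerate $r$-Stirling numbers of the first kind ${n+r \brack k+r}_{r,\lambda}$ ($0\le k\le n$) are defined by the polynomial identity $$\langle y+r\rangle_{n}=\sum_{k=0}^{n}{n+r \brack k+r}_{r,\lambda}\langle y\rangle_{k,\lambda}\quad (n\ge 0).$$ *)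

(* Defs.v *)
From HB Require Import structures.
From mathcomp Require Import all_boot all_order all_algebra.
From mathcomp Require Import boolp functions reals.
From mathcomp Require Export complex.

Set Implicit Arguments.
Unset Strict Implicit.
Unset Printing Implicit Defensive.

Import GRing.Theory.
Local Open Scope ring_scope.

(* [f : fps K] is given by its coefficients: [f n] is the coefficient of x^n.
   Addition and scaling are pointwise. *)
Definition fps (K : comNzRingType) := nat -> K.

HB.instance Definition _ (K : comNzRingType) :=
  GRing.Lmodule.copy (fps K) (nat -> K^o).

Definition fps_mul (K : comNzRingType) (f g : fps K) : fps K :=
  fun n => \sum_(i < n.+1) f i * g (n - i)%N.

Definition fps_X (K : comNzRingType) : fps K := fun n => (n == 1%N)%:R.

Definition opX (K : comNzRingType) (f : fps K) : fps K := fps_mul (fps_X K) f.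

Definition opD (K : comNzRingType) (f : fps K) : fps K :=
  fun n => n.+1%:R * f n.+1.

(* The operator T(T - lam)...(T - (n-1)lam), a composition of n factors. *)
Definition op_dffact (K : comNzRingType) (lam : K) (T : fps K -> fps K)
    (n : nat) : fps K -> fps K :=
  \big[comp/id]_(i < n) (fun f => T f - (i%:R * lam) *: f).

Definition rfact (A : comNzRingType) (y : A) (n : nat) : A :=
  \prod_(i < n) (y + i%:R).

Definition drfact (A : comNzRingType) (lam y : A) (n : nat) : A :=
  \prod_(i < n) (y + i%:R * lam).

Section RStirling1.
Variables (R : realType) (lam : R) (r : nat).

Lemma drfact_polyE n :
  drfact lam%:P 'X n = \prod_(i < n) ('X - (- (i%:R * lam))%:P) :> {poly R}.
Proof.
by apply: eq_bigr => i _; rewrite polyCN opprK polyCM polyC_natr.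
Qed.

Lemma monic_drfact n : (drfact lam%:P 'X n : {poly R}) \is monic.
Proof. by rewrite drfact_polyE monic_prod_XsubC. Qed.

Lemma size_drfact n : size (drfact lam%:P 'X n : {poly R}) = n.+1.
Proof. by rewrite drfact_polyE size_prod_XsubC /index_enum -enumT size_enum_ord. Qed.

Lemma drfact_span n (p : {poly R}) : (size p <= n)%N ->
  exists c : nat -> R, p = \sum_(k < n) c k *: drfact lam%:P 'X k.
Proof.
elim: n p => [|n IHn] p sz_p.
  by exists (fun=> 0); rewrite big_ord0; apply/eqP; rewrite -size_poly_leq0.
have bn : (drfact lam%:P 'X n : {poly R})`_n = 1.
  by have /monicP := monic_drfact n; rewrite lead_coefE size_drfact.
have [|c Ec] := IHn (p - p`_n *: drfact lam%:P 'X n).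
  apply/leq_sizeP => j; rewrite leq_eqVlt => /predU1P[<-|lt_nj].
    by rewrite coefB coefZ bn mulr1 subrr.
  have bj : (drfact lam%:P 'X n : {poly R})`_j = 0.
    by rewrite nth_default ?size_drfact.
  by rewrite coefB coefZ bj mulr0 subr0 (nth_default 0 (leq_trans sz_p lt_nj)).
exists (fun k => if k == n then p`_n else c k).
rewrite big_ord_recr /= eqxx -[LHS](subrK (p`_n *: drfact lam%:P 'X n)) Ec.
congr (_ + _); apply: eq_bigr => i _.
by rewrite ltn_eqF.
Qed.

Lemma drfact_free n (c : nat -> R) :
  \sum_(k < n) c k *: drfact lam%:P 'X k = 0 :> {poly R} ->
  forall k, (k < n)%N -> c k = 0.
Proof.
elim: n => [//|n IHn]; rewrite big_ord_recr /= => E.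
have cn0 : c n = 0.
  have := congr1 (fun p : {poly R} => p`_n) E.
  rewrite coefD coefZ coef0 coef_sum big1 => [|i _]; last first.
    by rewrite coefZ nth_default ?mulr0 // size_drfact.
  have /monicP := monic_drfact n; rewrite lead_coefE size_drfact /= => ->.
  by rewrite add0r mulr1.
move: E; rewrite cn0 scale0r addr0 => /IHn c0 k.
by rewrite ltnS leq_eqVlt => /predU1P[->|/c0].
Qed.

Lemma size_rfact n : size (rfact ('X + r%:R) n : {poly R}) = n.+1.
Proof.
rewrite /rfact (eq_bigr (fun i : 'I_n => 'X - (- (r%:R + i%:R))%:P)) => [|i _].
  by rewrite size_prod_XsubC /index_enum -enumT size_enum_ord.
by rewrite polyCN opprK polyCD !polyC_natr addrA.
Qed.

Definition drStirling1_spec (S : nat -> nat -> R) :=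
  forall n, rfact ('X + r%:R) n =
    \sum_(k < n.+1) S n k *: drfact lam%:P 'X k :> {poly R}.

Lemma drStirling1_exists : exists S, drStirling1_spec S.
Proof.
have H n := cid (drfact_span (eq_leq (size_rfact n))).
by exists (fun n => sval (H n)) => n; exact: svalP (H n).
Qed.

Lemma drStirling1_unique S S' : drStirling1_spec S -> drStirling1_spec S' ->
  forall n k, (k <= n)%N -> S n k = S' n k.
Proof.
move=> HS HS' n k le_kn; apply/eqP; rewrite -subr_eq0; apply/eqP.
apply: (@drfact_free n.+1 (fun k => S n k - S' n k)) => //.
under eq_bigr do rewrite scalerBl.
by rewrite sumrB -HS -HS' subrr.
Qed.

(* [drStirling1 n k], for k <= n, is the number with indices n + r over k + r;
   its value for k > n is unspecified. *)
Definition drStirling1 : nat -> nat -> R := sval (cid drStirling1_exists).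

Lemma drStirling1P : drStirling1_spec drStirling1.
Proof. exact: svalP (cid drStirling1_exists). Qed.

End RStirling1.

(* Main.v *)
(* In the monomial basis all the operators involved are diagonal: x^k D^k
   multiplies the coefficient of x^n by the falling factorial (n)_k, and
   (xD + r)_{m,lam} multiplies it by (n + r)_{m,lam}.  The identity between
   these eigenvalues is the polynomial identity defining the r-Stirling numbers,
   evaluated at y = -(n + r), up to the signs (-1)^k and (-1)^m. *)
Require Import Defs.
From mathcomp Require Import all_boot all_order all_algebra.
From mathcomp Require Import reals.
From mathcomp Require Import boolp.
Import GRing.Theory.
Local Open Scope ring_scope.
Local Open Scope complex_scope.

Section Coefficients.
Variable K : comNzRingType.
Implicit Types (f : fps K) (T : fps K -> fps K) (a : nat -> K).

Lemma fps_sumE I (s : seq I) (P : pred I) (F : I -> fps K) n :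
  (\sum_(i <- s | P i) F i) n = \sum_(i <- s | P i) F i n.
Proof. exact: (big_morph (fun f : fps K => f n)). Qed.

Lemma opXE f n : opX f n = if n is m.+1 then f m else 0.
Proof.
rewrite /opX /fps_mul /fps_X; case: n => [|n].
  by rewrite big_ord1 mul0r.
rewrite 2!big_ord_recl /= mul0r add0r mul1r big1 ?addr0 => [|i _].
  by rewrite subSS subn0.
by rewrite mul0r.
Qed.

Lemma iter_opXE k f n :
  iter k (@opX K) f n = if (k <= n)%N then f (n - k)%N else 0.
Proof.
elim: k n => [|k IHk] n; first by rewrite subn0.
by rewrite iterS opXE; case: n => [|n] //; rewrite IHk ltnS subSS.
Qed.

Lemma iter_opDE k f n :
  iter k (@opD K) f n = ((n + k) ^_ k)%:R * f (n + k)%N.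
Proof.
elim: k n => [|k IHk] n; first by rewrite addn0 mul1r.
(* The outermost [opD] contributes [n.+1], the last factor of the falling factorial of [n + k.+1]
   with [k.+1] factors. *)
rewrite iterS /opD IHk addSnnS mulrA -natrM mulnC ffactnSr.
by rewrite addnS subSn ?leq_addl // addnK.
Qed.

Lemma iter_opX_opDE k f n :
  iter k (@opX K) (iter k (@opD K) f) n = (n ^_ k)%:R * f n.
Proof.
rewrite iter_opXE; case: leqP => [le_kn|lt_nk].
  by rewrite iter_opDE subnK.
by rewrite ffact_small // mul0r.
Qed.

Lemma opX_opDE f n : opX (opD f) n = n%:R * f n.
Proof. by have := iter_opX_opDE 1 f n; rewrite ffactn1. Qed.

(** Each factor of the composition rescales the coefficient of x^n on its own, so composing the
    factors multiplies their eigenvalues. *)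
Lemma op_dffact_diag lam T a m f n : (forall g j, T g j = a j * g j) ->
  op_dffact lam T m f n = (\prod_(i < m) (a n - i%:R * lam)) * f n.
Proof.
move=> TE; rewrite /op_dffact.
elim/big_rec2: _ => [|i y U _ IH]; first by rewrite mul1r.
by rewrite -mulrA -IH mulrBl -TE.
Qed.

Lemma natr_ffact n k : (n ^_ k)%:R = \prod_(i < k) (n%:R - i%:R) :> K.
Proof.
elim: k => [|k IHk]; first by rewrite big_ord0.
rewrite ffactnSr natrM big_ord_recr /= IHk.
(* The subtraction [n - k] is truncated when [n < k], but there [n ^_ k] is already 0 and both sides
   vanish. *)
case: (leqP k n) => [le_kn|lt_nk]; first by rewrite natrB.
by rewrite -IHk ffact_small // !mul0r.
Qed.

End Coefficients.

Lemma prodrN_ord (K : comNzRingType) n (F : 'I_n -> K) :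
  \prod_(i < n) - F i = (-1) ^+ n * \prod_(i < n) F i.
Proof. by rewrite prodrN card_ord. Qed.

Lemma drStirling1_ffact (R : realType) (lam : R) (r k n : nat) :
  (n ^_ k)%:R = \sum_(m < k.+1) (-1) ^+ (k - m) * drStirling1 lam r k m *
    \prod_(i < m) (n%:R + r%:R - i%:R * lam).
Proof.
(* At y = -(n + r) the factor y + r + i becomes -(n - i); the k signs make up (-1)^k. *)
have -> : (n ^_ k)%:R = (-1) ^+ k * (rfact ('X + r%:R) k).[- (n%:R + r%:R)] :> R.
  rewrite natr_ffact horner_prod -prodrN_ord; apply: eq_bigr => i _.
  rewrite !hornerD hornerX -!polyC_natr !hornerC.
  by rewrite 2!opprD opprK addrK.
rewrite (drStirling1P lam) horner_sum mulr_sumr; apply: eq_bigr => m _.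
have le_mk : (m <= k)%N by rewrite -ltnS.
(* Split (-1)^k as (-1)^(k-m) (-1)^m; the second power negates the m factors -(n + r) + i lam. *)
rewrite hornerZ horner_prod mulrCA -[in (-1) ^+ k](subnK le_mk).
rewrite exprD -[in LHS]mulrA -prodrN_ord mulrA (mulrC (drStirling1 _ _ _ _)).
congr (_ * _); apply: eq_bigr => i _.
by rewrite hornerD hornerX -polyC_natr -polyCM hornerC opprD opprK.
Qed.

Theorem theorem3 (R : realType) (lam : R) (r : nat) (f : fps R[i]) (k : nat) :
  iter k (@opX R[i]) (iter k (@opD R[i]) f) =
  \sum_(m < k.+1)
    ((-1) ^+ (k - m) * (drStirling1 lam r k m)%:C) *:
      op_dffact lam%:C (fun g => opX (opD g) + r%:R *: g) m f.
Proof.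
apply: funext => n; rewrite iter_opX_opDE fps_sumE.
(* The Stirling numbers are real, so the eigenvalue identity is applied over [R] and carried to
   [R[i]] by the embedding. *)
rewrite -(rmorph_nat (real_complex R)) (drStirling1_ffact _ lam r).
rewrite rmorph_sum mulr_suml.
apply: eq_bigr => m _; rewrite [RHS]/GRing.scale /=.
rewrite (@op_dffact_diag _ _ _ (fun j => j%:R + r%:R)) => [|g j].
  rewrite [RHS]mulrA !rmorphM rmorphXn rmorphN1 rmorph_prod; congr (_ * _ * _).
  apply: eq_bigr => i _.
  by rewrite rmorphB rmorphD rmorphM !rmorph_nat.
by rewrite mulrDl -opX_opDE.
Qed.
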